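(* Let $N$ be a simple cographic matroid of rank $n-1$, and let $c$ be a colouring of the ground set $E(N)$ using $n$ colours such that each colour class has size at least $2$. Then $N$ has a circuit of size at most $\lceil n/2 \rceil$ whose elements all have distinct colours (a rainbow circuit).
   Context: A matroid is a finite ground set $E$ with a collection of nonempty, inclusion-incomparable subsets called circuits satisfying the circuit elimination axiom. A set is independent if it contains no circuit; the rank of the matroid is the size of a largest independent set. A matroid is simple if it has no circuits of size $1$ or $2$. For a graph $G$, an edge-cut is a set $C^*$ of edges such that $G \setminus C^*$ has more connected components than $G$; a cocycle is an inclusion-minimal edge-cut. The cocycle matroid $M(G)^*$ has ground set $E(G)$ and circuits the cocycles of $G$. A matroid is cographic if it is isomorphic to $M(G)^*$ for some graph $G$. *)

(* Defs.v *)
From mathcomp Require Import all_boot.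
Set Implicit Arguments.
Unset Strict Implicit.
Unset Printing Implicit Defensive.

Record matroid := Matroid {
  ground :> finType;
  circuits : {set {set ground}};
  circuits_neq0 : set0 \notin circuits;
  circuits_incomparable : forall C1 C2 : {set ground},
    C1 \in circuits -> C2 \in circuits -> C1 \subset C2 -> C1 = C2;
  circuits_elimination : forall (C1 C2 : {set ground}) (e : ground),
    C1 \in circuits -> C2 \in circuits -> C1 != C2 -> e \in C1 :&: C2 ->
    exists2 C3 : {set ground}, C3 \in circuits & C3 \subset (C1 :|: C2) :\ e
}.

Definition independent (N : matroid) (I : {set N}) : bool :=
  [forall C in circuits N, ~~ (C \subset I)].

Definition rank (N : matroid) : nat :=
  \max_(I : {set N} | independent I) #|I|.

Definition simple (N : matroid) : Prop :=
  forall C : {set N}, C \in circuits N -> (#|C| != 1) && (#|C| != 2).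

Definition isomorphic (N M : matroid) : Prop :=
  exists2 f : N -> M, bijective f &
    forall C : {set N}, (f @: C \in circuits M) = (C \in circuits N).

(* Loops and parallel edges are allowed; the order of the two ends of an edge
   is an arbitrary choice that [adjacent] forgets. *)
Record graph := Graph {
  vertex : finType;
  edge : finType;
  ends : edge -> vertex * vertex
}.

(* Adjacency in the graph obtained from G by deleting the edges in C. *)
Definition adjacent (G : graph) (C : {set edge G}) : rel (vertex G) :=
  fun x y => [exists e, (e \notin C) &&
                        ((ends e == (x, y)) || (ends e == (y, x)))].

Definition components (G : graph) (C : {set edge G}) : nat :=
  n_comp (adjacent C) (vertex G).

Definition edge_cut (G : graph) (C : {set edge G}) : bool :=
  components (set0 : {set edge G}) < components C.

Definition cocycles (G : graph) : {set {set edge G}} :=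
  [set C | minset (@edge_cut G) C].

Section CocycleMatroid.
Variable G : graph.
Implicit Types (C D : {set edge G}) (A : {set vertex G}).

Lemma adjacent_sym C : symmetric (adjacent C).
Proof. by move=> x y; apply: eq_existsb => e; rewrite orbC. Qed.

Lemma adjacent_csym C : connect_sym (adjacent C).
Proof. exact/sym_connect_sym/adjacent_sym. Qed.

Lemma adjacentP C x y :
  reflect (exists2 e, e \notin C & ends e = (x, y) \/ ends e = (y, x))
          (adjacent C x y).
Proof.
apply: (iffP existsP) => [[e /andP[eC /orP[]/eqP h]]|[e eC h]].
- by exists e => //; left.
- by exists e => //; right.
by exists e; rewrite eC /=; case: h => ->; rewrite eqxx ?orbT.
Qed.

Lemma adjacent_ends C e :
  e \notin C -> adjacent C (ends e).1 (ends e).2.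
Proof. by move=> eC; apply/adjacentP; exists e => //; left; case: (ends e). Qed.

Lemma connect_subset C D x y :
  C \subset D -> connect (adjacent D) x y -> connect (adjacent C) x y.
Proof.
move=> sCD; apply: connect_sub => {}x {}y /adjacentP[e eD h].
apply/connect1/adjacentP; exists e => //.
by apply: contra eD; apply/subsetP.
Qed.

Lemma ltn_components C D x y : C \subset D ->
  connect (adjacent C) x y -> ~~ connect (adjacent D) x y ->
  components C < components D.
Proof.
move=> sCD Cxy nDxy; have cC := adjacent_csym C; have cD := adjacent_csym D.
pose rC := [set z | roots (adjacent C) z].
pose rD := [set z | roots (adjacent D) z].
have nE E : components E = #|[set z | roots (adjacent E) z]|.
  by rewrite cardsE; apply: eq_card => z; rewrite !inE andbT.
pose f := root (adjacent D).
have rCD z : connect (adjacent C) z (f z).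
  exact: connect_subset sCD (connect_root _ z).
have fI : {in rC &, injective f}.
  move=> a b; rewrite !inE => /eqP ra /eqP rb fab.
  rewrite -ra -rb; apply/eqP; rewrite root_connect //.
  by apply: connect_trans (rCD a) _; rewrite fab cC.
have [w wf wC] : exists2 w, w \in rD & w \notin f @: rC.
  have fD z : f z \in rD by rewrite inE roots_root.
  have key z : f z \in f @: rC -> f z = f (root (adjacent C) z).
    case/imsetP => a; rewrite inE => /eqP ra fz; rewrite fz.
    congr f; rewrite -ra; apply/eqP; rewrite root_connect //.
    by apply: connect_trans (rCD a) _; rewrite -fz cC.
  case hx: (f x \in f @: rC); last by exists (f x); rewrite ?hx.
  case hy: (f y \in f @: rC); last by exists (f y); rewrite ?hy.
  case/negP: nDxy; rewrite -root_connect //; apply/eqP.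
  rewrite -/f (key _ hx) (key _ hy); congr f.
  by apply/eqP; rewrite root_connect.
rewrite !nE -(card_in_imset fI); apply/proper_card/properP; split; last first.
  by exists w.
by apply/subsetP => _ /imsetP[a _ ->]; rewrite inE roots_root.
Qed.

Lemma edge_cutP C :
  reflect (exists2 e, e \in C & ~~ connect (adjacent C) (ends e).1 (ends e).2)
          (edge_cut C).
Proof.
apply: (iffP idP) => [cutC|[e eC nc]]; last first.
  apply: ltn_components nc; first exact: sub0set.
  by apply/connect1/adjacent_ends; rewrite inE.
apply/exists_inP; apply: contraLR cutC.
rewrite negb_exists_in => /forall_inP h.
rewrite -leqNgt /components leq_eqVlt; apply/orP; left; apply/eqP.
apply: eq_n_comp => x y; apply/idP/idP; first exact/connect_subset/sub0set.
apply: connect_sub => {}x {}y /adjacentP[e _ he].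
have : connect (adjacent C) (ends e).1 (ends e).2.
  case eC: (e \in C); first by have := h _ eC; rewrite negbK.
  by apply/connect1/adjacent_ends; rewrite eC.
by case: he => -> //=; rewrite adjacent_csym.
Qed.

Definition coboundary A : {set edge G} :=
  [set e | ((ends e).1 \in A) != ((ends e).2 \in A)].

Lemma coboundary_edge_cut A : coboundary A != set0 -> edge_cut (coboundary A).
Proof.
case/set0Pn => e eA; apply/edge_cutP; exists e => //.
apply/negP => h; move: eA; rewrite inE; apply/negP/negPn/eqP.
suff cl : closed (adjacent (coboundary A)) (mem A) by exact: closed_connect cl _ _ h.
move=> x y /adjacentP[d]; rewrite inE negbK => /eqP dA.
by case=> hd; move: dA; rewrite hd.
Qed.

Lemma cocycle_coboundary C : C \in cocycles G ->
  exists A, C = coboundary A.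
Proof.
rewrite inE => /minsetP[/edge_cutP[e eC nce] minC].
have notcut D : D \subset C -> D != C -> ~~ edge_cut D.
  by move=> sDC; apply: contra => cD; apply/eqP/minC.
set u := (ends e).1 in nce; set v := (ends e).2 in nce.
have cC := adjacent_csym C.
(* the component of u in G \ C *)
exists [set x | connect (adjacent C) u x].
apply/setP => f; rewrite !inE; case fC: (f \in C); last first.
  apply/esym/negbTE; rewrite negbK; apply/eqP.
  exact: (same_connect_r cC (connect1 (adjacent_ends (negbT fC)))).
have ncf : ~~ connect (adjacent C) (ends f).1 (ends f).2.
  apply/negP => cf.
  have := notcut (C :\ f) (subD1set _ _).
  have -> : C :\ f != C.
    by apply/eqP => /setP/(_ f); rewrite !inE eqxx fC.
  move/(_ isT)/negP; apply; apply/edge_cutP.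
  have sub x y : connect (adjacent (C :\ f)) x y -> connect (adjacent C) x y.
    apply: connect_sub => {}x {}y /adjacentP[d dC hd].
    case: (eqVneq d f) => [df|ndf]; last first.
      apply/connect1/adjacentP; exists d => //.
      by apply: contra dC; rewrite !inE ndf.
    by move: cf; rewrite -df; case: hd => -> //=; rewrite cC.
  exists e; last by apply: contra nce => /sub.
  rewrite !inE eC andbT; apply/eqP => ef; move: nce; rewrite /u /v ef.
  by rewrite cf.
have: connect (adjacent (C :\ e)) (ends f).1 (ends f).2.
  case: (eqVneq f e) => [->|nfe].
    by apply/connect1/adjacent_ends; rewrite !inE eqxx.
  apply/negPn/negP => nc.
  have := notcut (C :\ e) (subD1set _ _).
  have -> : C :\ e != C.
    by apply/eqP => /setP/(_ e); rewrite !inE eqxx eC.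
  move/(_ isT)/negP; apply; apply/edge_cutP.
  by exists f; rewrite // !inE nfe.
(* merging the components of u and v gives a set closed in (G \ C) + e *)
pose U x := connect (adjacent C) u x; pose W x := connect (adjacent C) v x.
have step x y : adjacent (C :\ e) x y ->
    connect (adjacent C) x y \/ (U x /\ W y) \/ (W x /\ U y).
  case/adjacentP => d dC hd; case: (eqVneq d e) => [de|nde]; last first.
    left; apply/connect1/adjacentP; exists d => //.
    by apply: contra dC; rewrite !inE nde.
  right; rewrite /U /W /u /v -de.
  by case: hd => -> /=; [left|right]; rewrite !connect0.
have path_case x y : connect (adjacent (C :\ e)) x y ->
    connect (adjacent C) x y \/ (U x \/ W x) /\ (U y \/ W y).
  case/connectP => p; elim: p x => [|z p IH] x /=.
    by move=> _ ->; left.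
  case/andP => /step xz /IH{}IH /IH zy.
  case: xz => [xz|xz]; case: zy => [zy|[Uz Uy]].
  - by left; apply: connect_trans xz zy.
  - right; split=> //; case: Uz => Uz; [left|right];
      by apply: connect_trans Uz _; rewrite cC.
  - right; case: xz => -[Ux Uz]; split; try (by [left|right]).
      by right; apply: connect_trans Uz zy.
    by left; apply: connect_trans Uz zy.
  - by right; split=> //; case: xz => -[Ux _]; [left|right].
case/path_case => [cf|[h1 h2]]; first by rewrite cf in ncf.
have UW x : W x -> ~~ U x.
  move=> Wx; apply: contra nce => Ux.
  by apply: connect_trans Ux _; rewrite cC.
apply/esym; rewrite -/(U _) -/(U _).
case: h1 => h1; case: h2 => h2.
- by case/negP: ncf; apply: connect_trans h2; rewrite cC.
- by rewrite h1 (negbTE (UW _ h2)).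
- by rewrite h2 (negbTE (UW _ h1)).
- by case/negP: ncf; apply: connect_trans h2; rewrite cC.
Qed.

Lemma cocycles_neq0 : set0 \notin cocycles G.
Proof.
by rewrite inE; apply/negP => /minsetp; rewrite /edge_cut ltnn.
Qed.

Lemma cocycles_incomparable C1 C2 :
  C1 \in cocycles G -> C2 \in cocycles G -> C1 \subset C2 -> C1 = C2.
Proof. by rewrite !inE => /minsetp c1 /minsetP[_]; apply. Qed.

Lemma cocycles_elimination C1 C2 e :
  C1 \in cocycles G -> C2 \in cocycles G -> C1 != C2 -> e \in C1 :&: C2 ->
  exists2 C3, C3 \in cocycles G & C3 \subset (C1 :|: C2) :\ e.
Proof.
move=> /cocycle_coboundary[A ->] /cocycle_coboundary[B ->] nAB eAB.
pose X := [set x | (x \in A) != (x \in B)].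
have XE f : (f \in coboundary X) =
    ((f \in coboundary A) != (f \in coboundary B)).
  by rewrite !inE; do 4 case: (_ \in _).
have /coboundary_edge_cut/minset_exists[C3 minC3 sC3] : coboundary X != set0.
  apply: contraNneq nAB => X0; apply/eqP/setP => f.
  by apply/eqP/negPn; rewrite -XE X0 inE.
exists C3; first by rewrite inE.
apply: subset_trans sC3 _; apply/subsetP => f; rewrite XE in_setD1 in_setU.
case: (eqVneq f e) => [->|_] /=; last by do 2 case: (f \in _).
by move: eAB; rewrite in_setI => /andP[-> ->].
Qed.

Definition cocycle_matroid : matroid :=
  Matroid cocycles_neq0 cocycles_incomparable cocycles_elimination.

End CocycleMatroid.

Definition cographic (N : matroid) : Prop :=
  exists G : graph, isomorphic N (cocycle_matroid G).

Definition rainbow (N : matroid) (K : Type) (c : N -> K) (C : {set N}) : Prop :=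
  {in C &, injective c}.

(* Main.v *)
Require Import Defs.
From mathcomp Require Import all_boot.
From mathcomp Require Import zify.

(** Let the matroid be M(G)^* and k the number of components of G, so
    that |E| - n = |V| - k - 1.  Choose a maximal set S of colours such that
    contracting the union of its classes loses at most (number of edges) -
    (number of colours) vertices.  In the contracted graph, with E' edges and
    n' colours, the relation |V'| >= E' - n' + k + 1 survives, and by
    maximality every remaining class, of size m say, is a forest, so at most
    m - 1 vertices see it twice.  Summing, at most E' - n' vertices have a
    non-rainbow star, whereas at least E' - n' + 2 vertices are not isolated.
    Thus two non-isolated vertices u, w have rainbow stars; since nonempty cuts
    have at least 3 edges, deg u + deg w + 3 (E' - n') <= 2 E', and E' >= 2 n'
    gives deg u + deg w <= n'.  The smaller star contains the circuit. *)

(** * Contractions of a graph: component and star counts *)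

Section Contraction.
Variable G : graph.
Implicit Types (F D : {set edge G}) (x y v : vertex G).

(* [joined F], [ncomp F] and [reps F] describe the graph with edge set [F],
   whereas [adjacent] and [components] take the set of deleted edges.  The
   vertices of the contraction G / F are represented by [reps F], and [star F v]
   is the set of non-loop edges of G / F at [v]. *)
Definition joined F : rel (vertex G) := connect (adjacent (~: F)).
Definition ncomp F : nat := components (~: F).
Definition reps F : {set vertex G} := [set z | roots (adjacent (~: F)) z].
Definition star F v : {set edge G} := coboundary [set x | joined F v x].

Lemma joined_sym F x y : joined F x y = joined F y x.
Proof. exact: adjacent_csym. Qed.

Lemma joined_ends F e : e \in F -> joined F (ends e).1 (ends e).2.
Proof. by move=> eF; apply/connect1/adjacent_ends; rewrite inE negbK. Qed.

Lemma card_reps F : #|reps F| = ncomp F.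
Proof. by rewrite cardsE; apply: eq_card => z; rewrite !inE andbT. Qed.

Lemma reps_joined F x y : x \in reps F -> y \in reps F -> joined F x y -> x = y.
Proof.
rewrite !inE => /eqP {2}<- /eqP {2}<- xy; apply/eqP.
by rewrite root_connect //; apply: adjacent_csym.
Qed.

Lemma ncomp0 : ncomp set0 = #|vertex G|.
Proof.
rewrite -card_reps -cardsT; apply: eq_card => x; rewrite !inE.
have: joined set0 x (root (adjacent (~: set0)) x) by apply: connect_root.
case/connectP => -[|y p] /=; first by move=> _ h; apply/eqP.
by case/andP => /adjacentP[e]; rewrite !inE.
Qed.

Lemma ltn_ncomp F e : ~~ joined F (ends e).1 (ends e).2 ->
  ncomp (e |: F) < ncomp F.
Proof.
move=> nj; apply: ltn_components nj; first by rewrite setCS subsetUr.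
by apply: joined_ends; rewrite setU11.
Qed.

Lemma ncomp_mono F D : F \subset D -> ncomp D <= ncomp F.
Proof.
move=> sFD; rewrite -!card_reps.
have cF := adjacent_csym (~: F); have cD := adjacent_csym (~: D).
have rI : {in reps D &, injective (root (adjacent (~: F)))}.
  move=> x y xD yD /eqP; rewrite root_connect // => xy.
  by apply: (reps_joined _ _ _ xD yD); apply: connect_subset xy; rewrite setCS.
rewrite -(card_in_imset rI); apply/subset_leq_card/subsetP.
by move=> _ /imsetP[x _ ->]; rewrite inE roots_root.
Qed.

(** A set [T] maximal for the inequality spans: an edge between two of its components could be
    added, since it lowers [ncomp]. *)
Lemma spanning_forest : exists T : {set edge G},
  #|T| + ncomp T <= #|vertex G| /\ ncomp T = ncomp setT.
Proof.
have P0 : #|@set0 (edge G)| + ncomp set0 <= #|vertex G| by rewrite cards0 ncomp0.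
have [T /maxsetP[PT maxT] _] := @maxset_exists _
  (fun T : {set edge G} => #|T| + ncomp T <= #|vertex G|) _ P0.
exists T; split=> //; apply/eqP; rewrite eqn_leq (ncomp_mono _ _ (subsetT T)) andbT.
have allj e : joined T (ends e).1 (ends e).2.
  apply/negPn/negP => nj.
  have eT : e \notin T by apply: contra nj => /joined_ends.
  have lt := ltn_ncomp _ _ nj.
  have : e |: T = T.
    by apply: maxT; rewrite ?subsetUr // cardsU1 eT; move: PT; cbn; lia.
  by move=> h; rewrite -h setU11 in eT.
rewrite leq_eqVlt; apply/orP; left; apply/eqP.
apply: eq_n_comp => x y; apply/idP/idP.
  by apply: connect_subset; rewrite setCS subsetT.
apply: connect_sub => {}x {}y /adjacentP[e _ he].
by have := allj e; case: he => -> //=; rewrite joined_sym.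
Qed.

Lemma starP F v e : e \in star F v ->
  joined F (ends e).1 v != joined F (ends e).2 v.
Proof. by rewrite !inE ![joined F v _]joined_sym. Qed.

Lemma star_disjoint F v e : e \in F -> e \notin star F v.
Proof.
move=> eF; apply/negP => /starP; rewrite /joined.
by rewrite (same_connect (adjacent_csym _) (joined_ends _ _ eF)) eqxx.
Qed.

(** An edge can lie only in the stars of the representatives of its two ends. *)
Lemma star_count F D : \sum_(v in reps F) #|star F v :&: D| <= 2 * #|D|.
Proof.
have cF := adjacent_csym (~: F).
under eq_bigr do rewrite -sum1_card big_mkcond.
rewrite exchange_big /= mulnC -sum_nat_const [leqRHS]big_mkcond /=.
apply: leq_sum => e _; case: ifP => eD; last first.
  by rewrite big1 // => v _; rewrite inE eD andbF.
rewrite -big_mkcondr sum1_card.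
pose r := root (adjacent (~: F)).
apply: (@leq_trans #|[set r (ends e).1; r (ends e).2]|); last first.
  by rewrite cards2; case: (_ != _).
apply/subset_leq_card/subsetP => v; rewrite unfold_in => /andP[vF].
rewrite in_setI => /andP[/starP ev _].
have rE x : joined F x v -> v == r x.
  move=> xv; move: vF; rewrite inE => /eqP {1}<-.
  by rewrite /r root_connect // adjacent_csym.
rewrite !inE; case h: (joined F (ends e).1 v); first by rewrite rE.
by rewrite [v == r (ends e).2]rE ?orbT //; move: ev; rewrite h; case: joined.
Qed.

Definition touched F D : {set vertex G} :=
  [set v in reps F | star F v :&: D != set0].

(** No edge of [D] leaves the [F]-class of [x], so the [D]-component of [x] stays inside that
    class. *)
Lemma untouched_joined F D x y : x \in reps F :\: touched F D ->
  y \in reps F -> joined D x y -> x = y.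
Proof.
rewrite !in_setD inE => /andP[+ xF] yF xy.
rewrite xF /= negbK => /eqP s0; apply: (reps_joined F) => //.
have cl : closed (adjacent (~: D)) (mem [set z | joined F x z]).
  move=> z t /adjacentP[e eD he].
  have : e \notin star F x :&: D by rewrite s0 inE.
  rewrite in_setI; rewrite inE negbK in eD; rewrite eD andbT inE negbK => /eqP.
  by case: he => ->.
have := closed_connect cl xy; rewrite !inE => <-; exact: connect0.
Qed.

(** Each untouched vertex of G / F has a component of [D] to itself, and the touched ones, if any,
    account for at least one more. *)
Lemma ncomp_touched F D :
  ncomp F + (touched F D != set0) <= ncomp D + #|touched F D|.
Proof.
have cD := adjacent_csym (~: D); have sub : touched F D \subset reps F.
  by apply/subsetP => x; rewrite inE => /andP[].
have main (U : {set vertex G}) : U \subset reps F ->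
    #|U :&: touched F D| <= 1 -> #|U| <= ncomp D.
  move=> sU U1; have rI : {in U &, injective (root (adjacent (~: D)))}.
    move=> x y xU yU /eqP; rewrite root_connect // => xy.
    have [xF yF] := (subsetP sU _ xU, subsetP sU _ yU).
    case xT: (x \in touched F D); last first.
      by apply: (@untouched_joined F D); rewrite // in_setD xT.
    case yT: (y \in touched F D); last first.
      apply/esym; apply: (@untouched_joined F D); rewrite // ?in_setD ?yT //.
      by rewrite joined_sym.
    by apply: (card_le1_eqP U1); rewrite in_setI ?xU ?yU.
  rewrite -(card_in_imset rI) -card_reps; apply/subset_leq_card/subsetP.
  by move=> _ /imsetP[x _ ->]; rewrite inE roots_root.
have cT := cardsID (touched F D) (reps F).
rewrite (setIidPr sub) card_reps in cT.
have [T0|[t tT]] := set_0Vmem (touched F D).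
  rewrite T0 eqxx cards0 !addn0 -card_reps; apply: main => //.
  by rewrite T0 setI0 cards0.
have -> : touched F D != set0 by apply/set0Pn; exists t.
have tN : t \notin reps F :\: touched F D by rewrite in_setD tT.
have := main (t |: (reps F :\: touched F D)); rewrite cardsU1 tN => H.
suff : 1 + #|reps F :\: touched F D| <= ncomp D by lia.
apply: H; first by rewrite subUset sub1set (subsetP sub) // subsetDl.
rewrite -(cards1 t); apply/subset_leq_card/subsetP => z.
by rewrite in_setI in_setU1 in_setD in_set1; case: (z == t) => //;
   case: (z \in touched F D); rewrite ?andbF.
Qed.

(* If D is a forest of the quotient by F, with m edges, it covers at least
   m + 1 vertices, so its degree sum 2m leaves at most m - 1 vertices of
   degree 2 or more. *)
Lemma forest_branching F D : 0 < #|D| -> ncomp (F :|: D) + #|D| <= ncomp F ->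
  #|[set v in reps F | 1 < #|star F v :&: D|]| < #|D|.
Proof.
move=> D0 forest; have := ncomp_touched F (F :|: D); have := star_count F D.
(* Edges of [F] are loops of G / F, so they touch nothing. *)
have -> : touched F (F :|: D) = touched F D.
  apply/setP => v; rewrite !in_set; congr (_ && (_ != _)).
  apply/setP => e; rewrite !in_setI in_setU.
  by case eF: (e \in F); rewrite // (negbTE (star_disjoint _ v _ eF)).
set B := [set v in _ | _] => cnt.
(* Every touched vertex counts once, and every vertex of [B] once more. *)
have : #|touched F D| + #|B| <= \sum_(v in reps F) #|star F v :&: D|.
  rewrite -!sum1_card [X in X + _]big_mkcond [X in _ + X]big_mkcond -big_split /=.
  rewrite [leqRHS]big_mkcond /=; apply: leq_sum => v _.
  rewrite !in_set -cards_eq0; case: (roots _ v) => //=.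
  by case: #|_ :&: _| => [|[|k]].
(* If nothing were touched, [ncomp] would not drop, contradicting [forest] and [D0]. *)
have [->|_] := eqVneq (touched F D) set0; rewrite ?cards0; lia.
Qed.

(** * Edge colourings and the search for a short rainbow star *)

Section Colouring.
Variables (K : finType) (c : edge G -> K).
Hypothesis cut_ge3 : forall C, C \in cocycles G -> 2 < #|C|.
Hypothesis class_ge2 : forall i, 1 < #|[set e | c e == i]|.
(** This is the bound of [rank_cographic] when [#|K|] is the rank plus one. *)
Hypothesis corank : #|edge G| + ncomp setT < #|vertex G| + #|K|.

Definition class_union (S : {set K}) : {set edge G} := [set e | c e \in S].

Lemma card_class_union (S : {set K}) :
  #|class_union S| = \sum_(i in S) #|[set e | c e == i]|.
Proof.
rewrite -sum1_card (partition_big c (mem S)) /=; last by move=> e; rewrite inE.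
apply: eq_bigr => i iS; rewrite -sum1_card; apply: eq_bigl => e.
by rewrite !inE; case: eqP => [->|]; rewrite ?andbF ?andbT.
Qed.

(** Take [S] maximal for the first inequality: a class violating the second could be added to
    [S]. *)
Lemma exists_acyclic_contraction : exists S : {set K},
  #|vertex G| + #|S| <= ncomp (class_union S) + #|class_union S| /\
  forall i, i \notin S ->
    ncomp (class_union S :|: [set e | c e == i]) + #|[set e | c e == i]|
      <= ncomp (class_union S).
Proof.
pose P (S : {set K}) :=
  #|vertex G| + #|S| <= ncomp (class_union S) + #|class_union S|.
have P0 : P set0.
  rewrite /P (_ : class_union set0 = set0) ?ncomp0 ?cards0 //.
  by apply/setP => e; rewrite !inE.
have [S /maxsetP[PS maxS] _] := maxset_exists P0.
exists S; split=> // i iS.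
have nP : ~~ P (i |: S).
  apply/negP => /maxS/(_ (subsetUr _ _)) h.
  by move: iS; rewrite -h setU11.
have uE : class_union (i |: S) = class_union S :|: [set e | c e == i].
  by apply/setP => e; rewrite !inE orbC.
move: nP PS; rewrite /P card_class_union big_setU1 // -card_class_union.
rewrite cardsU1 iS uE /=; lia.
Qed.

Lemma star_ge3 F v : star F v != set0 -> 2 < #|star F v|.
Proof.
move/coboundary_edge_cut/minset_exists => [C minC sC].
by apply: leq_trans (subset_leq_card sC); apply: cut_ge3; rewrite inE.
Qed.

Lemma short_rainbow_cocycle : exists C : {set edge G},
  [/\ C \in cocycles G, 2 * #|C| <= #|K| & {in C &, injective c}].
Proof.
have [S [Srank Sfor]] := exists_acyclic_contraction.
set F := class_union S in Srank Sfor.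
have starS v : star F v = star F v :&: ~: F.
  apply/esym/setIidPl/subsetP => e.
  by rewrite in_setC; apply: contraL => /star_disjoint->.
have cF := cardsC F; have cS := cardsC S.
have cEF : #|~: F| = \sum_(i in ~: S) #|[set e | c e == i]|.
  by rewrite -card_class_union; apply: eq_card => e; rewrite !inE.
have E2 : 2 * #|~: S| <= #|~: F|.
  by rewrite cEF mulnC -sum_nat_const; apply: leq_sum.
set W := touched F setT.
(* One unit comes from the strictness of [corank], the other from the component containing touched
   vertices; [E2] excludes an empty [W]. *)
have Wge : #|~: F| + 2 <= #|W| + #|~: S|.
  have := ncomp_touched F setT; rewrite -/W; move: corank.
  have [->|_] := eqVneq W set0; rewrite ?cards0; lia.
pose bad i := [set v in reps F | 1 < #|star F v :&: [set e | c e == i]|].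
have badlt i : i \in ~: S -> #|bad i| < #|[set e | c e == i]|.
  rewrite in_setC => iS; apply: forest_branching; last exact: Sfor.
  exact: ltnW (class_ge2 i).
have badle : #|\bigcup_(i in ~: S) bad i| + #|~: S| <= #|~: F|.
  rewrite cEF -[#|~: S|]sum1_card.
  apply: leq_trans (_ : \sum_(i in ~: S) (#|bad i| + 1) <= _).
    rewrite big_split leq_add2r /=.
    elim/big_ind2: _ => [|A a B b hA hB|//]; first by rewrite cards0.
    by apply: leq_trans (leq_card_setU _ _) _; apply: leq_add.
  by apply: leq_sum => i iS; rewrite addn1 badlt.
pose good := W :\: \bigcup_(i in ~: S) bad i.
have goodge : 1 < #|good|.
  have := cardsID (\bigcup_(i in ~: S) bad i) W; rewrite -/good.
  have : #|W :&: \bigcup_(i in ~: S) bad i| <= #|\bigcup_(i in ~: S) bad i|.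
    by apply/subset_leq_card/subsetIr.
  lia.
(* An edge of a star avoids [F], so its colour is outside [S], and a repetition of it would make [v]
   bad. *)
have rb v : v \in good -> {in star F v &, injective c}.
  rewrite in_setD => /andP[nbad vW] e d es ds ced.
  apply/eqP/negPn/negP => ned; case/negP: nbad; apply/bigcupP; exists (c e).
    by move: es; rewrite starS !inE => /andP[].
  move: vW; rewrite !in_set => /andP[-> _] /=.
  apply/card_gt1P; exists e, d; split=> //; rewrite in_setI ?es ?ds inE ?eqxx //.
  by rewrite ced eqxx.
case/card_gt1P: goodge => u [w [ug wg nuw]].
have Wstar v : v \in W -> 2 < #|star F v|.
  by rewrite inE setIT => /andP[_]; apply: star_ge3.
have [uW wW] : u \in W /\ w \in W.
  by move: ug wg; rewrite !in_setD => /andP[_ ->] /andP[_ ->].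
have degs : #|star F u| + #|star F w| + 3 * (#|W| - 2) <= 2 * #|~: F|.
  apply: leq_trans (star_count F (~: F)); under eq_bigr do rewrite -starS.
  apply: (@leq_trans (\sum_(v in W) #|star F v|)); last first.
    rewrite [leqLHS]big_mkcond [leqRHS]big_mkcond /=; apply: leq_sum => v _.
    by case: ifP => //; rewrite inE => /andP[-> _].
  rewrite (big_setD1 u) //= (big_setD1 w) /=; last first.
    by rewrite in_setD1 eq_sym nuw.
  rewrite -addnA !leq_add2l.
  have -> : #|W| - 2 = #|W :\ u :\ w|.
    have := cardsD1 u W; have := cardsD1 w (W :\ u).
    by rewrite uW in_setD1 wW eq_sym nuw /=; lia.
  rewrite mulnC -sum_nat_const; apply: leq_sum => v.
  by rewrite !in_setD1 => /and3P[_ _ /Wstar].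
(* By [degs], [Wge] and [E2], the two degrees add up to at most
   [3 * #|~: S| - #|~: F| <= #|~: S|]. *)
have [x xg xle] : exists2 x, x \in good & 2 * #|star F x| <= #|K|.
  have [le|lt] := leqP #|star F u| #|star F w|; [exists u|exists w] => //; lia.
have xW : x \in W by move: xg; rewrite in_setD => /andP[].
have : star F x != set0 by rewrite -cards_eq0; have := Wstar _ xW; case: #|_|.
case/coboundary_edge_cut/minset_exists => C minC sC.
exists C; split; first by rewrite inE.
  by have := subset_leq_card sC; rewrite -/(star F x); lia.
by move=> e d /(subsetP sC) eC /(subsetP sC) dC; apply: (rb x).
Qed.

End Colouring.
End Contraction.

(** * Transfer between the matroid and the graph *)

(** The complement of a spanning forest [T] is independent: deleting edges outside [T] creates no
    new component. *)
Lemma rank_cographic (N : matroid) (G : graph) (f : N -> edge G) :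
  bijective f ->
  (forall C : {set N}, (f @: C \in circuits (cocycle_matroid G)) =
                       (C \in circuits N)) ->
  #|edge G| + ncomp G setT <= #|vertex G| + rank N.
Proof.
move=> bf fC; have [g gK fK] := bf.
have [T [cT nT]] := spanning_forest G.
have cI : #|f @^-1: (~: T)| = #|~: T|.
  by rewrite on_card_preimset //; exists g => x _.
have indep : independent (f @^-1: (~: T)).
  apply/forall_inP => C; rewrite -fC inE => /minsetp cutC; apply/negP => sC.
  have sCT : f @: C \subset ~: T.
    by apply/subsetP => _ /imsetP[x /(subsetP sC) + ->]; rewrite inE.
  move: cutC; apply/negP; rewrite -leqNgt.
  rewrite -[f @: C]setCK -[set0]setCK setC0 -/(ncomp _ _) -/(ncomp _ _) -nT.
  by apply: ncomp_mono; rewrite -[T]setCK setCS.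
have := @leq_bigmax_cond _ (@independent N) (fun I : {set N} => #|I|) _ indep.
rewrite -/(rank N) cI; have := cardsC T; lia.
Qed.

Theorem theorem4p2 (N : matroid) (n : nat) (c : N -> 'I_n)
  (N_simple : simple N) (N_cographic : cographic N)
  (N_rank : (rank N).+1 = n)
  (c_classes : forall i : 'I_n, 2 <= #|[set e : N | c e == i]|) :
  exists C : {set N}, [/\ C \in circuits N, #|C| <= uphalf n & rainbow c C].
Proof.
have [G [f bf fC]] := N_cographic; have [g gK fK] := bf.
have rk := rank_cographic N G f bf fC.
have imK (C : {set edge G}) : f @: (g @: C) = C.
  by rewrite -imset_comp -[RHS]imset_id; apply: eq_imset => e /=; rewrite fK.
have gC (C : {set edge G}) : (g @: C \in circuits N) = (C \in cocycles G).
  by rewrite -fC imK.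
have gI : injective g := can_inj fK.
have cut3 C : C \in cocycles G -> 2 < #|C|.
  move=> CG; have := N_simple (g @: C); rewrite gC => /(_ CG).
  have C0 : C != set0 by apply: contraTneq CG => ->; apply: cocycles_neq0.
  by move: C0; rewrite -cards_eq0 card_imset //; case: #|C| => [|[|[|k]]].
have class2 i : 1 < #|[set e | c (g e) == i]|.
  apply: leq_trans (c_classes i) _; rewrite -(card_imset _ (can_inj gK)).
  apply/subset_leq_card/subsetP => _ /imsetP[x + ->].
  by rewrite !inE gK.
have [|C [CG sz rbC]] := short_rainbow_cocycle G 'I_n (c \o g) cut3 class2.
  by rewrite card_ord -N_rank; lia.
exists (g @: C); split; first by rewrite gC.
  (* After doubling, it remains to see that [n <= 2 * uphalf n]. *)
  rewrite card_imset // -leq_double -mul2n; move: sz; rewrite card_ord => sz.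
  apply: leq_trans sz _; rewrite -{1}(odd_double_half n) uphalf_half doubleD.
  by rewrite leq_add2r -addnn leq_addr.
move=> _ _ /imsetP[x xC ->] /imsetP[y yC ->] h; congr g; exact: rbC.
Qed.
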